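(* Let $R$ be a maximal subring of a reduced ring $T$. Then $Z({}_RT)=Z(T_R)$, and $Z:=Z({}_RT)=Z(T_R)$ is a proper ideal of $T$. Moreover, either $Z=0$ or the following hold: (1) $R\oplus Z=T$. In particular, $Z$ is a minimal ideal of $T$. In fact, for each $0\neq x\in Z$, we have $RxT=Z=TxR$. (2) $(R:T)=(R:T)_l=(R:T)_r=ann_R(Z)$, and this ideal contains $Soc(R)$. Moreover, $Q=ann_T(Z)$ is a minimal prime ideal of $T$ and $Q\cap R=(R:T)$. (3) For each prime ideal $P$ of $T$ minimal over $Z$, $T/P\cong R/(R\cap P)$ is a domain. (4) $T/R$ is a left and right singular $R$-module.
   Context: All rings are associative and unital (not necessarily commutative), and subrings contain the identity of the big ring; ''ideal'' means two-sided ideal, and a minimal ideal is a minimal nonzero ideal. A ring is reduced if it has no nonzero nilpotent elements. A maximal subring $R$ of $T$ is a proper subring with no subring strictly between $R$ and $T$. For a left $R$-module $M$, $Z({}_RM)$ is its singular submodule, i.e. the set of $m\in M$ whose annihilator $l.ann_R(m)$ is an essential left ideal of $R$; $Z(M_R)$ is defined analogously for right modules; a module is singular if it equals its singular submodule. $RxT$ denotes the set of finite sums $\sum r_ixt_i$ with $r_i\in R$, $t_i\in T$, and similarly for $TxR$. Conductors: $(R:T)=\{x\in T: TxT\subseteq R\}$, $(R:T)_l=\{x\in T: Tx\subseteq R\}$, $(R:T)_r=\{x\in T: xT\subseteq R\}$. For $S\in\{R,T\}$, $ann_S(Z)=\{s\in S: sZ=Zs=0\}$. Since $R$ is reduced,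 $Soc({}_RR)=Soc(R_R)$, and this ideal is denoted $Soc(R)$. *)

(* Defs.v *)
From HB Require Import structures.
From mathcomp Require Import all_boot all_algebra.
From mathcomp Require Import boolp classical_sets.

Set Implicit Arguments.
Unset Strict Implicit.
Unset Printing Implicit Defensive.

Import GRing.Theory.
Local Open Scope ring_scope.
Local Open Scope quotient_scope.
Local Open Scope classical_set_scope.

(* Right modules over a ring A are left modules over the converse ring A^c;  *)
(* right ideals of A are the submodules of the regular module (A^c)^o.       *)

Section Modules.
Variables (A : pzRingType) (M : lmodType A).
Implicit Types N L : set M.

Definition submodule N : Prop :=
  [/\ N 0, (forall x y, N x -> N y -> N (x + y))
    & forall (a : A) x, N x -> N (a *: x)].

Definition essential_submodule N : Prop :=
  submodule N /\
  forall L, submodule L -> L <> [set 0] -> N `&` L <> [set 0].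

Definition simple_submodule N : Prop :=
  [/\ submodule N, N <> [set 0]
    & forall L, submodule L -> L `<=` N -> L = [set 0] \/ L = N].

Definition socle : set M :=
  [set x | exists s : seq M,
     (forall y, y \in s -> exists2 N, simple_submodule N & N y) /\
     x = \sum_(y <- s) y].

Definition annihilator (m : M) : set A^o := [set a | (a : A) *: m = 0].

End Modules.

Definition singular_submodule (A : pzRingType) (M : lmodType A) : set M :=
  [set m | essential_submodule (annihilator m)].

Definition singular_module (A : pzRingType) (M : lmodType A) : Prop :=
  @singular_submodule A M = [set: M].

Section Rings.
Variable T : pzRingType.
Implicit Types (A B I J P X : set T) (x : T).

Definition reduced : Prop := forall x n, x ^+ n = 0 -> x = 0.

Definition domain : Prop :=
  (1 : T) <> 0 /\ forall x y : T, x * y = 0 -> x = 0 \/ y = 0.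

Definition two_sided_ideal I : Prop :=
  [/\ I 0, (forall x y, I x -> I y -> I (x + y))
    & forall a x, I x -> I (a * x) /\ I (x * a)].

Definition minimal_ideal I : Prop :=
  [/\ two_sided_ideal I, I <> [set 0]
    & forall J, two_sided_ideal J -> J `<=` I -> J = [set 0] \/ J = I].

Definition prime_ideal P : Prop :=
  [/\ two_sided_ideal P, P <> setT
    & forall I J, two_sided_ideal I -> two_sided_ideal J ->
        (forall x y, I x -> J y -> P (x * y)) -> I `<=` P \/ J `<=` P].

Definition minimal_prime_over I P : Prop :=
  [/\ prime_ideal P, I `<=` P
    & forall P', prime_ideal P' -> I `<=` P' -> P' `<=` P -> P' = P].

Definition minimal_prime P : Prop := minimal_prime_over [set 0] P.

Definition sums_of_products A x B : set T :=
  [set y | exists s : seq (T * T),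
     (forall p, p \in s -> A p.1 /\ B p.2) /\
     y = \sum_(p <- s) p.1 * x * p.2].

Definition conductor A : set T := [set x | sums_of_products setT x setT `<=` A].
Definition lconductor A : set T := [set x | forall t, A (t * x)].
Definition rconductor A : set T := [set x | forall t, A (x * t)].

Definition ann_in A X : set T :=
  [set s | A s /\ forall x, X x -> s * x = 0 /\ x * s = 0].

Definition internal_direct_sum A B : Prop :=
  [set a + b | a in A & b in B] = setT /\ A `&` B = [set 0].

Definition maximal_subring (R : subringClosed T) : Prop :=
  [set` R] <> setT /\
  forall S : subringClosed T, [set` R] `<=` [set` S] ->
    [set` S] = [set` R] \/ [set` S] = setT.

End Rings.

Definition ring_isomorphic (A B : pzRingType) : Prop :=
  exists f : {rmorphism A -> B}, bijective f.

HB.mixin Record isTwoSidedClosed (T : pzRingType) (I : {pred T}) := {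
  idealMl : forall a, {in I, forall x, a * x \in I};
  idealMr : forall a, {in I, forall x, x * a \in I}
}.

#[short(type="idealClosed")]
HB.structure Definition IdealClosed (T : pzRingType) :=
  {I of GRing.ZmodClosed T I & isTwoSidedClosed T I}.

Definition ring_quot (T : pzRingType) (I : idealClosed T) : Type :=
  Quotient.quot I.

Section RingQuotient.
Variables (T : pzRingType) (I : idealClosed T).
Local Notation Q := (ring_quot I).
Local Notation pi := (\pi_(Quotient.quot I) : T -> Q).

HB.instance Definition _ := GRing.Zmodule.on Q.

Definition ring_quot_one : Q := pi 1.
Definition ring_quot_mul (x y : Q) : Q :=
  pi (repr (x : Quotient.quot I) * repr (y : Quotient.quot I)).

Lemma ring_quot_eq (x y : T) : (pi x = pi y) <-> (x - y \in I).
Proof.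
by rewrite Quotient.idealrBE; split=> [->|/eqP].
Qed.

Lemma ring_quotP (x : Q) : exists t, x = pi t.
Proof. by exists (repr (x : Quotient.quot I)); rewrite reprK. Qed.

Lemma ring_quot_repr (t : T) : repr (\pi_(Quotient.quot I) t) - t \in I.
Proof. by apply/ring_quot_eq; rewrite reprK. Qed.

Lemma ring_quot_mulE (x y : T) : ring_quot_mul (pi x) (pi y) = pi (x * y).
Proof.
apply/ring_quot_eq; set x' := repr _; set y' := repr _.
have -> : x' * y' - x * y = (x' - x) * y' + x * (y' - y).
  by rewrite mulrBl mulrBr addrA subrK.
by apply: rpredD; [apply: idealMr | apply: idealMl]; exact: ring_quot_repr.
Qed.

Lemma ring_quot_addE (x y : T) : pi x + pi y = pi (x + y).
Proof. exact: esym (raddfD \pi_(Quotient.quot I) x y). Qed.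

Fact ring_quot_mulA : associative ring_quot_mul.
Proof.
move=> x y z; have [[a ->] [b ->] [c ->]] :=
  And3 (ring_quotP x) (ring_quotP y) (ring_quotP z).
by rewrite !ring_quot_mulE mulrA.
Qed.

Fact ring_quot_mul1 : left_id ring_quot_one ring_quot_mul.
Proof. by move=> x; have [a ->] := ring_quotP x; rewrite ring_quot_mulE mul1r. Qed.

Fact ring_quot_mulr1 : right_id ring_quot_one ring_quot_mul.
Proof. by move=> x; have [a ->] := ring_quotP x; rewrite ring_quot_mulE mulr1. Qed.

Fact ring_quot_mulDl : left_distributive ring_quot_mul +%R.
Proof.
move=> x y z; have [[a ->] [b ->] [c ->]] :=
  And3 (ring_quotP x) (ring_quotP y) (ring_quotP z).
by rewrite !(ring_quot_addE, ring_quot_mulE) mulrDl.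
Qed.

Fact ring_quot_mulDr : right_distributive ring_quot_mul +%R.
Proof.
move=> x y z; have [[a ->] [b ->] [c ->]] :=
  And3 (ring_quotP x) (ring_quotP y) (ring_quotP z).
by rewrite !(ring_quot_addE, ring_quot_mulE) mulrDr.
Qed.

HB.instance Definition _ := GRing.Zmodule_isPzRing.Build Q
  ring_quot_mulA ring_quot_mul1 ring_quot_mulr1 ring_quot_mulDl ring_quot_mulDr.

End RingQuotient.

Section Subring.
Variables (T : pzRingType) (R : subringClosed T).

Definition subring : Type := {x : T | x \in R}.
HB.instance Definition _ := SubChoice.on subring.
HB.instance Definition _ := GRing.SubChoice_isSubPzRing.Build T (fun x => x \in R) subring
  (GRing.subringClosedP R).

Definition restrict_ideal (P : idealClosed T) : {pred subring} :=
  [pred r | val r \in P].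

Section RestrictIdeal.
Variable P : idealClosed T.

Fact restrict_ideal_zmod : zmod_closed (restrict_ideal P).
Proof.
split=> [|x y]; first by rewrite inE raddf0 rpred0.
by rewrite !inE raddfB; exact: rpredB.
Qed.
HB.instance Definition _ :=
  GRing.isZmodClosed.Build subring (restrict_ideal P) restrict_ideal_zmod.

Fact restrict_idealMl a :
  {in restrict_ideal P, forall x, a * x \in restrict_ideal P}.
Proof. by move=> x; rewrite !inE rmorphM; exact: idealMl. Qed.
Fact restrict_idealMr a :
  {in restrict_ideal P, forall x, x * a \in restrict_ideal P}.
Proof. by move=> x; rewrite !inE rmorphM; exact: idealMr. Qed.
HB.instance Definition _ :=
  isTwoSidedClosed.Build subring (restrict_ideal P)
    restrict_idealMl restrict_idealMr.

End RestrictIdeal.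

Definition left_module (_ : subringClosed T) : Type := T.
HB.instance Definition _ := GRing.Zmodule.on (left_module R).

Definition left_scale (r : subring) (t : left_module R) : left_module R :=
  (val r : T) * (t : T).

Fact left_scaleA a b v : left_scale a (left_scale b v) = left_scale (a * b) v.
Proof. exact: mulrA. Qed.
Fact left_scale1 : left_id 1 left_scale.
Proof. exact: (@mul1r T). Qed.
Fact left_scaleDr : right_distributive left_scale +%R.
Proof. by move=> a; exact: (@mulrDr T). Qed.
Fact left_scaleDl v : {morph left_scale^~ v : a b / a + b}.
Proof. by move=> a b; exact: (@mulrDl T). Qed.
HB.instance Definition _ := GRing.Zmodule_isLmodule.Build subring
  (left_module R)
  left_scaleA left_scale1 left_scaleDr left_scaleDl.

Definition right_module (_ : subringClosed T) : Type := T.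
HB.instance Definition _ := GRing.Zmodule.on (right_module R).

Definition right_scale (r : subring^c) (t : right_module R) : right_module R :=
  (t : T) * (val (r : subring) : T).

Fact right_scaleA a b v :
  right_scale a (right_scale b v) = right_scale (a * b) v.
Proof. exact: esym (mulrA _ _ _). Qed.
Fact right_scale1 : left_id 1 right_scale.
Proof. exact: (@mulr1 T). Qed.
Fact right_scaleDr : right_distributive right_scale +%R.
Proof. by move=> a x y; exact: (@mulrDl T). Qed.
Fact right_scaleDl v : {morph right_scale^~ v : a b / a + b}.
Proof. by move=> a b; exact: (@mulrDr T). Qed.
HB.instance Definition _ := GRing.Zmodule_isLmodule.Build subring^c
  (right_module R)
  right_scaleA right_scale1 right_scaleDr right_scaleDl.

Local Notation pi := (\pi_(Quotient.quot R)).

Lemma factor_eq (x y : T) : (pi x = pi y) <-> (x - y \in R).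
Proof. by rewrite Quotient.idealrBE; split=> [->|/eqP]. Qed.

Lemma factor_repr (t : T) : repr (pi t) - t \in R.
Proof. by apply/factor_eq; rewrite reprK. Qed.

Lemma factorP (x : Quotient.quot R) : exists t, x = pi t.
Proof. by exists (repr x); rewrite reprK. Qed.

Definition left_factor : Type := Quotient.quot R.
HB.instance Definition _ := GRing.Zmodule.on left_factor.

Definition left_factor_scale (r : subring) (x : left_factor) : left_factor :=
  pi (val r * repr (x : Quotient.quot R)).

Lemma left_factor_scaleE r (t : T) :
  left_factor_scale r (pi t) = pi (val r * t).
Proof.
apply: (proj2 (factor_eq _ _)).
by rewrite -mulrBr; apply: rpredM (valP r) (factor_repr t).
Qed.

Fact left_factor_scaleA a b v :
  left_factor_scale a (left_factor_scale b v) = left_factor_scale (a * b) v.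
Proof. by have [t ->] := factorP v; rewrite !left_factor_scaleE rmorphM mulrA. Qed.
Fact left_factor_scale1 : left_id 1 left_factor_scale.
Proof. by move=> v; have [t ->] := factorP v; rewrite left_factor_scaleE rmorph1 mul1r. Qed.
Fact left_factor_scaleDr : right_distributive left_factor_scale +%R.
Proof.
move=> a u v; have [[s ->] [t ->]] := conj (factorP u) (factorP v).
rewrite -[X in left_factor_scale _ X](raddfD pi) !left_factor_scaleE mulrDr.
exact: (raddfD pi).
Qed.
Fact left_factor_scaleDl v : {morph left_factor_scale^~ v : a b / a + b}.
Proof.
move=> a b; have [t ->] := factorP v; rewrite !left_factor_scaleE rmorphD mulrDl.
exact: (raddfD pi).
Qed.
HB.instance Definition _ := GRing.Zmodule_isLmodule.Build subring left_factor
  left_factor_scaleA left_factor_scale1 left_factor_scaleDr left_factor_scaleDl.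

Definition right_factor : Type := Quotient.quot R.
HB.instance Definition _ := GRing.Zmodule.on right_factor.

Definition right_factor_scale (r : subring^c) (x : right_factor) :
    right_factor :=
  pi (repr (x : Quotient.quot R) * val (r : subring)).

Lemma right_factor_scaleE (r : subring) (t : T) :
  right_factor_scale r (pi t) = pi (t * val r).
Proof.
apply: (proj2 (factor_eq _ _)).
by rewrite -mulrBl; apply: rpredM (factor_repr t) (valP r).
Qed.

Fact right_factor_scaleA a b v :
  right_factor_scale a (right_factor_scale b v) = right_factor_scale (a * b) v.
Proof. by have [t ->] := factorP v; rewrite !right_factor_scaleE -mulrA -rmorphM. Qed.
Fact right_factor_scale1 : left_id 1 right_factor_scale.
Proof. by move=> v; have [t ->] := factorP v; rewrite right_factor_scaleE rmorph1 mulr1. Qed.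
Fact right_factor_scaleDr : right_distributive right_factor_scale +%R.
Proof.
move=> a u v; have [[s ->] [t ->]] := conj (factorP u) (factorP v).
rewrite -[X in right_factor_scale _ X](raddfD pi) !right_factor_scaleE mulrDl.
exact: (raddfD pi).
Qed.
Fact right_factor_scaleDl v : {morph right_factor_scale^~ v : a b / a + b}.
Proof.
move=> a b; have [t ->] := factorP v; rewrite !right_factor_scaleE.
rewrite rmorphD mulrDr.
exact: (raddfD pi).
Qed.
HB.instance Definition _ :=
  GRing.Zmodule_isLmodule.Build subring^c right_factor right_factor_scaleA
    right_factor_scale1 right_factor_scaleDr right_factor_scaleDl.

Definition left_singular : set T :=
  @singular_submodule subring (left_module R).
Definition right_singular : set T :=
  @singular_submodule subring^c (right_module R).

(* Soc(_R R) and Soc(R_R), seen inside T; they coincide when R is reduced *)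
Definition left_socle : set T :=
  [set val (r : subring) | r in @socle subring subring^o].
Definition right_socle : set T :=
  [set val (r : subring) | r in @socle subring^c (subring^c)^o].

End Subring.

Arguments restrict_ideal {T} R P.

(* Main.v *)
(** In a reduced ring xy = 0 implies yx = 0 and xty = 0, so the annihilator of
    t in R is a two-sided ideal, and it is essential on either side iff its own
    annihilator in R vanishes.  Hence Z(_R T) and Z(T_R) agree, form an ideal Z
    of T, and Z meets R trivially.  If Z <> 0, every nonzero X inside Z that is
    normalized by R and closed under sums and products satisfies R + X = T by
    maximality, so X = Z by the modular law; this covers RxT, TxR and nonzero
    ideals.  Minimality of Z makes its annihilator a minimal prime, and the
    conductor computations follow from T = R + Z and R /\ Z = 0.  Finally T/Z,
    being isomorphic to R, is reduced, and a minimal prime of a reduced ring is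
    completely prime. *)

From HB Require Import structures.
Require Import Defs.
From mathcomp Require Import all_boot all_algebra.
From mathcomp Require Import boolp classical_sets.
Import GRing.Theory.
Local Open Scope ring_scope.
Local Open Scope classical_set_scope.

(** * Two-sided ideals, sums of products, and primeness in terms of elements *)

Section Ideals.
Context {T : pzRingType}.
Implicit Types (A B I J P : set T) (x y z : T) (s : seq T).

Lemma two_sided_idealB {I x y} : two_sided_ideal I -> I x -> I y -> I (x - y).
Proof.
case=> _ ID IM Ix Iy; apply: ID => //.
by rewrite -mulN1r; exact: (IM _ _ Iy).1.
Qed.

Lemma two_sided_ideal0 : two_sided_ideal ([set 0] : set T).
Proof.
split=> // [x y -> -> | a x ->]; first by rewrite /= addr0.
by rewrite /= mulr0 mul0r.
Qed.

Lemma two_sided_idealT {I} : two_sided_ideal I -> I 1 -> I = setT.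
Proof.
by case=> _ _ IM I1; apply/seteqP; split=> // t _; rewrite -[t]mulr1; exact: (IM _ _ I1).1.
Qed.

Lemma two_sided_idealI {I J} : two_sided_ideal I -> two_sided_ideal J ->
  two_sided_ideal (I `&` J).
Proof.
move=> [I0 ID IM] [J0 JD JM]; split=> // [x y [Ix Jx] [Iy Jy]|a x [Ix Jx]].
  by split; [exact: ID | exact: JD].
by have [[? ?] [? ?]] := (IM a x Ix, JM a x Jx); split; split.
Qed.

Lemma two_sided_idealD {I J} : two_sided_ideal I -> two_sided_ideal J ->
  two_sided_ideal [set a + b | a in I & b in J].
Proof.
move=> [I0 ID IM] [J0 JD JM]; split.
- by exists 0 => //; exists 0 => //; rewrite addr0.
- move=> _ _ [a Ia [b Jb <-]] [c Ic [d Jd <-]].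
  by exists (a + c); [exact: ID | exists (b + d); [exact: JD | rewrite addrACA]].
- move=> t _ [a Ia [b Jb <-]]; have [[Ita Iat] [Jtb Jbt]] := (IM t a Ia, JM t b Jb).
  split; first by exists (t * a) => //; exists (t * b) => //; rewrite mulrDr.
  by exists (a * t) => //; exists (b * t) => //; rewrite mulrDl.
Qed.

Lemma sums_of_products1 {A B} x : A 1 -> B 1 -> sums_of_products A x B x.
Proof.
move=> A1 B1; exists [:: (1, 1)]; split; last by rewrite big_seq1 mul1r mulr1.
by move=> p; rewrite inE => /eqP ->.
Qed.

Lemma sums_of_products_mul {A B x a b} :
  A a -> B b -> sums_of_products A x B (a * x * b).
Proof.
move=> Aa Bb; exists [:: (a, b)]; split; last by rewrite big_seq1.
by move=> p; rewrite inE => /eqP ->.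
Qed.

Lemma sums_of_products0 {A B} x : sums_of_products A x B 0.
Proof. by exists [::]; rewrite big_nil. Qed.

Lemma sums_of_productsD {A B x y z} :
  sums_of_products A x B y -> sums_of_products A x B z ->
  sums_of_products A x B (y + z).
Proof.
move=> [s [hs ->]] [u [hu ->]]; exists (s ++ u); split; last by rewrite big_cat.
by move=> p; rewrite mem_cat => /orP[]; [exact: hs | exact: hu].
Qed.

Lemma sums_of_products_sub {A B X : set T} {x} :
  X 0 -> (forall y z, X y -> X z -> X (y + z)) ->
  (forall a b, A a -> B b -> X (a * x * b)) ->
  sums_of_products A x B `<=` X.
Proof.
move=> X0 XD XM _ [s [hs ->]].
by rewrite big_seq; apply: big_ind => // p /hs[]; exact: XM.
Qed.

Lemma sums_of_products_mull {A B x y t} : (forall a, A a -> A (t * a)) ->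
  sums_of_products A x B y -> sums_of_products A x B (t * y).
Proof.
move=> AM; apply: (@sums_of_products_sub _ _ [set y | sums_of_products A x B (t * y)]).
- by rewrite /= mulr0; exact: sums_of_products0.
- by move=> u v /= hu hv; rewrite mulrDr; exact: sums_of_productsD.
- move=> a b Aa Bb /=; rewrite !mulrA; exact: (sums_of_products_mul (AM _ Aa)).
Qed.

Lemma sums_of_products_mulr {A B x y t} : (forall b, B b -> B (b * t)) ->
  sums_of_products A x B y -> sums_of_products A x B (y * t).
Proof.
move=> BM; apply: (@sums_of_products_sub _ _ [set y | sums_of_products A x B (y * t)]).
- by rewrite /= mul0r; exact: sums_of_products0.
- by move=> u v /= hu hv; rewrite mulrDl; exact: sums_of_productsD.
- move=> a b Aa Bb /=; rewrite -mulrA; exact: (sums_of_products_mul Aa (BM _ Bb)).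
Qed.

Lemma principal_ideal x : two_sided_ideal (sums_of_products setT x setT).
Proof.
split=> [|y z|t y hy]; [exact: sums_of_products0 | exact: sums_of_productsD |].
by split; [exact: sums_of_products_mull | exact: sums_of_products_mulr].
Qed.

(** If [x * t * y] were in [P] for all [t], the product of the principal ideals of [x] and [y] would
    lie in [P], hence so would one of the two ideals. *)
Lemma prime_ideal_insert {P x y} : prime_ideal P -> ~ P x -> ~ P y ->
  exists t, ~ P (x * t * y).
Proof.
move=> [[P0 PD PM] _ prP] Px Py; apply: contrapT => /forallNP h.
have PxTy u w : sums_of_products setT x setT u -> sums_of_products setT y setT w ->
    P (u * w).
  case=> s [_ ->]; apply: (@sums_of_products_sub _ _ [set w | P (_ * w)]) => /=.
  - by rewrite mulr0.
  - by move=> v v' Pv Pv'; rewrite mulrDr; exact: PD.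
  move=> a b _ _; rewrite mulr_suml; apply: big_ind => // p _.
  have -> : p.1 * x * p.2 * (a * y * b) = p.1 * (x * (p.2 * a) * y) * b.
    by rewrite !mulrA.
  by apply: (PM _ _ _).2; apply: (PM _ _ _).1; apply: contrapT; exact: h.
have [sub|sub] := prP _ _ (principal_ideal x) (principal_ideal y) PxTy.
- by apply: Px; apply: sub; exact: sums_of_products1.
- by apply: Py; apply: sub; exact: sums_of_products1.
Qed.

(** * Ideals with reduced quotient, and complete primeness of their minimal primes *)

Section ReducedModulo.
Context {I : set T} (idI : two_sided_ideal I) (redI : forall x, I (x * x) -> I x).

(** The square of [y * x] is [y * (x * y) * x]. *)
Lemma reduced_mulC x y : I (x * y) -> I (y * x).
Proof.
case: idI => _ _ IM Ixy; apply: redI.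
rewrite mulrA -(mulrA y x y) -mulrA mulrA.
by apply: (IM _ _ _).2; apply: (IM _ _ _).1.
Qed.

(** The square of [x * t * y] contains the factor [y * x], which [reduced_mulC] puts in [I]. *)
Lemma reduced_insert x t y : I (x * y) -> I (x * t * y).
Proof.
case: idI => _ _ IM Ixy; apply: redI.
have -> : x * t * y * (x * t * y) = (x * t) * (y * x) * (t * y) by rewrite !mulrA.
by apply: (IM _ _ _).2; apply: (IM _ _ _).1; exact: reduced_mulC.
Qed.

(** Primeness supplies elements to insert between the factors so that the product stays outside [P],
    whereas insertions never take a product out of [I], which lies in [P]. *)
Lemma prod_notin_prime P s : prime_ideal P -> I `<=` P ->
  (forall x, x \in s -> ~ P x) -> ~ I (\prod_(x <- s) x).
Proof.
move=> prP IP hs.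
(* Here [y] is the product with insertions; the left multiplier [w] lets the induction absorb the
   factors already treated. *)
suff [y Py hy] : exists2 y, ~ P y & forall w, I (w * \prod_(x <- s) x) -> I (w * y).
  by move=> Is; apply: Py; apply: IP; rewrite -[y]mul1r; apply: hy; rewrite mul1r.
elim: s hs => [|a s IHs] hs.
  exists 1; last by move=> w; rewrite big_nil.
  by case: prP => idP PT _ P1; apply: PT; exact: two_sided_idealT.
have [|y Py hy] := IHs; first by move=> x xs; apply: hs; rewrite inE xs orbT.
have [t Pt] := prime_ideal_insert prP (hs a (mem_head a s)) Py.
exists (a * t * y) => // w; rewrite big_cons mulrA => /hy Iway.
by rewrite !mulrA; exact: reduced_insert.
Qed.

(* An ideal maximal among those containing I and avoiding all products of
   elements outside P is prime and contained in P, hence equals P. *)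
Lemma minimal_prime_over_completely_prime P : minimal_prime_over I P ->
  forall x y, P (x * y) -> P x \/ P y.
Proof.
move=> [prP IP minP] x y Pxy.
pose M := [set m | exists2 s, (forall x, x \in s -> ~ P x) & m = \prod_(x <- s) x].
(* The conditions bear on the union with [I] because Zorn also requires the union of the empty
   chain, which is empty, to belong to [F]. *)
pose F := [set X | two_sided_ideal (X `|` I) /\ (forall m, (X `|` I) m -> ~ M m)].
have [I0 ID IM] := idI.
have M1 s : (forall x, x \in s -> ~ P x) -> M (\prod_(x <- s) x) by exists s.
have [G FG totG|X [[idJ JM] maxX]] := @Zorn_bigcup T F.
  have GU m : (\bigcup_(X in G) X `|` I) m -> I m \/ exists2 X, G X & X m.
    by case=> [[X GX Xm]|]; [right; exists X | left].
  have UG X m : G X -> (X `|` I) m -> (\bigcup_(X in G) X `|` I) m.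
    by move=> GX [Xm|]; [left; exists X | right].
  split; last first.
    move=> m /GU[Im [s hs Em]|[X GX Xm]]; last by apply: (FG _ GX).2; left.
    by apply: (@prod_notin_prime P s) => //; rewrite -Em.
  split; first by right.
    move=> u v /GU[Iu|[X GX Xu]] /GU[Iv|[Y GY Yv]].
    + by right; exact: ID.
    + by apply: (UG _ _ GY); have [[_ D _] _] := FG _ GY; apply: D; [right|left].
    + by apply: (UG _ _ GX); have [[_ D _] _] := FG _ GX; apply: D; [left|right].
    + have [XY|YX] := totG X Y GX GY.
      * by apply: (UG _ _ GY); have [[_ D _] _] := FG _ GY; apply: D; left; [apply: XY|].
      * by apply: (UG _ _ GX); have [[_ D _] _] := FG _ GX; apply: D; left; [|apply: YX].
  move=> a u /GU[Iu|[X GX Xu]]; first by have [? ?] := IM a u Iu; split; right.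
  have [[_ _ D] _] := FG _ GX; have [Xau Xua] := D a u (or_introl Xu).
  by split; apply: (UG _ _ GX).
set J := X `|` I in idJ JM.
have [J0 JD JMl] := idJ.
(* By maximality of [X], the strictly larger ideal [J + A] cannot avoid [M]. *)
have meetM A : two_sided_ideal A -> ~ A `<=` J ->
    exists m, M m /\ exists2 j, J j & exists2 a, A a & m = j + a.
  move=> idA AJ; pose K := [set j + a | j in J & a in A].
  have JK : J `<=` K by move=> j Jj; exists j => //; exists 0; [case: idA | rewrite addr0].
  have KI : K `|` I = K.
    by apply/seteqP; split=> [k [//|Ik]|k]; [apply: JK; right | left].
  apply: contrapT => nM; apply: (maxX K).
    split; first by move=> z Xz; apply: JK; left.
    move=> KX; apply: AJ => a Aa; left; apply: KX.
    by exists 0 => //; exists a => //; rewrite add0r.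
  split; rewrite KI; first exact: two_sided_idealD.
  by move=> _ [j Jj [a Aa <-]] Mm; apply: nM; exists (j + a); split=> //; exists j => //; exists a.
(* If neither [A] nor [B] lies in [J], some [j + a] and [k + b] are in [M], and so is their product;
   but its expansion lies in [J] once all products [a * b] do. *)
have prJ : prime_ideal J.
  split=> // [JT|A B idA idB AB].
    by apply: (JM 1); [rewrite JT | have := M1 [::]; rewrite big_nil; apply].
  apply: contrapT => /not_orP[/(meetM _ idA)[_ [[s hs ->] [j Jj [a Aa Ea]]]]].
  move=> /(meetM _ idB)[_ [[u hu ->] [k Jk [b Bb Eb]]]].
  apply: (JM (\prod_(x <- s ++ u) x)); last first.
    by apply: M1 => z; rewrite mem_cat => /orP[/hs|/hu].
  rewrite big_cat /= Ea Eb mulrDl; apply: (JD); first exact: (JMl _ _ Jj).2.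
  by rewrite mulrDr; apply: (JD); [exact: (JMl _ _ Jk).1 | exact: AB].
(* An element outside [P] is a one-factor member of [M]. *)
have JP : J `<=` P.
  move=> z Jz; apply: contrapT => Pz; apply: (JM z Jz).
  have := M1 [:: z]; rewrite big_seq1; apply.
  by move=> w; rewrite inE => /eqP->.
have EJ : J = P by apply: minP => //; move=> z Iz; right.
(* With [J = P], a two-factor member of [M] cannot lie in [P]. *)
apply: contrapT => /not_orP[Px Py]; apply: (JM (x * y)); first by rewrite EJ.
have := M1 [:: x; y]; rewrite big_cons big_seq1; apply.
by move=> z; rewrite !inE => /orP[] /eqP->.
Qed.

End ReducedModulo.
End Ideals.

(** * Essential annihilators and the socle *)

Section Modules.
Context {A : pzRingType}.
Implicit Types N : set A^o.

Lemma submodule_annihilator {M : lmodType A} (m : M) : submodule (annihilator m).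
Proof.
split=> [|x y xm ym|a x xm].
- exact: scale0r.
- by rewrite /annihilator /= scalerDl xm ym addr0.
- by rewrite /annihilator /= -scalerA xm scaler0.
Qed.

(** A submodule containing an essential one is essential. This later transfers singularity from an
    element of [T] to its class modulo [R]. *)
Lemma essential_annihilator_sub {M M' : lmodType A} (m : M) (m' : M') :
  (forall a : A, a *: m = 0 -> a *: m' = 0) ->
  essential_submodule (annihilator m) -> essential_submodule (annihilator m').
Proof.
move=> mm' [_ em]; split=> [|L sL L0 mL]; first exact: submodule_annihilator.
apply: (em L) => //; apply/seteqP; split=> [x [xm Lx]|_ ->].
  by rewrite -mL; split=> //; exact: mm'.
by split; [exact: scale0r | case: sL].
Qed.

Lemma submodule_neq0 N : submodule N -> N <> [set 0] -> exists2 x, N x & x <> 0.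
Proof.
move=> [N0 _ _] nN; apply: contrapT => h; apply: nN; apply/seteqP; split=> [x Nx|_ -> //].
by apply: contrapT => x0; apply: h; exists x.
Qed.

(** An essential submodule meets every simple submodule nontrivially, hence contains it. *)
Lemma socle_annihilator {M : lmodType A} (m : M) (x : A^o) :
  essential_submodule (annihilator m) -> socle x -> (x : A) *: m = 0.
Proof.
move=> [_ em] [s [hs ->]]; rewrite scaler_suml big_seq big1 // => y /hs[N [sN N0 minN] Ny].
have sIN : submodule (annihilator m `&` N).
  have [[a0 aD aM] [n0 nD nM]] := (submodule_annihilator m, sN).
  split=> // [u v [um Nu] [vm Nv]|a u [um Nu]]; split.
  - exact: aD.
  - exact: nD.
  - exact: aM.
  - exact: nM.
have [|/(em _ sN N0)//|IN] := minN _ sIN; first by move=> u [].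
by move: Ny; rewrite -IN => -[].
Qed.

(* For a two-sided annihilator in a reduced ring, essentiality amounts to
   having no nonzero right annihilator. *)
Lemma essential_annihilatorP {M : lmodType A} (m : M) :
  (forall x : A, x * x = 0 -> x = 0) ->
  (forall a b : A, a *: m = 0 -> (a * b) *: m = 0) ->
  essential_submodule (annihilator m) <->
  forall s : A, (forall a : A, a *: m = 0 -> a * s = 0) -> s = 0.
Proof.
move=> redA annMr; split=> [[_ em] s hs|h].
  have mulC (x y : A) : x * y = 0 -> y * x = 0.
    by move=> xy0; apply: redA; rewrite mulrA -(mulrA y) xy0 mulr0 mul0r.
  (* An element [b * s] of this left ideal that kills [m] satisfies [b * s * s = 0]; commuting the
     zero product gives [s * (b * s) = 0], so the square of [b * s] vanishes. *)
  pose L : set A^o := [set b * s | b in setT].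
  have sL : submodule L.
    split; first by exists 0 => //; rewrite mul0r.
      by move=> _ _ [b _ <-] [c _ <-]; exists (b + c) => //; rewrite mulrDl.
    by move=> a _ [b _ <-]; exists (a * b) => //; rewrite -mulrA.
  apply: contrapT => s0; apply: (em L sL).
    by move=> L0; apply: s0; have : L s; [exists 1 => //; rewrite mul1r | rewrite L0].
  apply/seteqP; split=> [y [ym [b _ bsy]]|_ ->]; last first.
    by split; [exact: scale0r | case: sL].
  rewrite -bsy in ym *; apply: redA.
  by rewrite -mulrA (mulC (b * s)) ?mulr0 //; exact: hs.
split=> [|L sL /(submodule_neq0 _ sL)[s Ls s0] mL]; first exact: submodule_annihilator.
(* For [a] killing [m], the element [a * s] lies in both [L] and the annihilator, so it is [0]. *)
apply: s0; apply: h => a am.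
have : (annihilator m `&` L) (a * s).
  by split; [exact: annMr | case: sL => _ _; apply].
by rewrite mL.
Qed.

End Modules.

(** * Enlarging a maximal subring *)

Section MaximalSubring.
Context {T : pzRingType} {R : subringClosed T}.
Hypothesis maxR : maximal_subring R.

(** The set [R + X] is a subring containing [R], strictly because [X] is not inside [R]; maximality
    makes it all of [T]. *)
Lemma maximal_subringD (X : set T) :
  X 0 -> (forall x y, X x -> X y -> X (x + y)) ->
  (forall x y, X x -> X y -> X (x * y)) ->
  (forall r x, r \in R -> X x -> X (r * x) /\ X (x * r)) ->
  ~ X `<=` [set` R] -> forall t, exists2 r, r \in R & exists2 x, X x & t = r + x.
Proof.
move=> X0 XD XM XR nXR t.
pose S : {pred T} := fun t => `[< exists2 r, r \in R & exists2 x, X x & t = r + x >].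
have RS r : r \in R -> r \in S.
  by move=> Rr; apply/asboolP; exists r => //; exists 0; rewrite ?addr0.
have closedS : subring_closed S.
  split; first by apply: RS; exact: rpred1.
    move=> _ _ /asboolP[r Rr [x Xx ->]] /asboolP[r' Rr' [x' Xx' ->]].
    apply/asboolP; exists (r - r'); first exact: rpredB.
    (* Negation on [X] is available as multiplication by [-1], an element of [R]. *)
    exists (x + -1 * x'); last by rewrite mulN1r opprD addrACA.
    by apply: XD => //; apply: (XR _ _ _ Xx').1; rewrite rpredN1.
  move=> _ _ /asboolP[r Rr [x Xx ->]] /asboolP[r' Rr' [x' Xx' ->]].
  apply/asboolP; exists (r * r'); first exact: rpredM.
  exists (r * x' + x * r' + x * x'); last by rewrite mulrDl !mulrDr !addrA.
  by apply: (XD); [apply: XD; [exact: (XR _ _ Rr Xx').1 | exact: (XR _ _ Rr' Xx).2] | exact: XM].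
pose S' : subringClosed T := HB.pack S (GRing.isSubringClosed.Build T S closedS).
have [RS'|ES|ES] := maxR.2 S'; first exact: RS.
  case: nXR => x Xx; rewrite -ES; apply/asboolP.
  by exists 0; [exact: rpred0 | exists x => //; rewrite add0r].
have : [set` S'] t by rewrite ES.
by move/asboolP.
Qed.

End MaximalSubring.

(** * The singular ideal of a reduced ring over a subring *)

Section Singular.
Context {T : pzRingType} {R : subringClosed T}.
Hypothesis redT : forall x : T, x * x = 0 -> x = 0.

Let mulC0 (x y : T) : x * y = 0 -> y * x = 0.
Proof. exact: (@reduced_mulC _ _ two_sided_ideal0 redT). Qed.

Let insert0 (x t y : T) : x * y = 0 -> x * t * y = 0.
Proof. exact: (@reduced_insert _ _ two_sided_ideal0 redT). Qed.

(** This is [essential_annihilatorP] with the elements of [R] read inside [T]; [insert0] provides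
    closure of the annihilator under right multiplication. *)
Lemma left_singularP (t : T) : left_singular R t <->
  forall s, s \in R -> (forall r, r \in R -> r * t = 0 -> r * s = 0) -> s = 0.
Proof.
rewrite /left_singular /singular_submodule /=.
rewrite essential_annihilatorP; last first.
- by move=> a b; exact: insert0.
- by move=> x xx; apply/val_inj; apply: redT; rewrite -rmorphM xx raddf0.
split=> h s.
  move=> Rs hs; apply: (congr1 val (h (Sub s Rs) _)) => a at0.
  by apply/val_inj; rewrite rmorphM raddf0; apply: hs => //; exact: valP.
move=> hs; apply/val_inj; rewrite raddf0; apply: h => [|r Rr rt0]; first exact: valP.
by have := congr1 val (hs (Sub r Rr) rt0); rewrite rmorphM raddf0.
Qed.

(** Over the converse ring all products of the criterion are reversed. [mulC0] turns them back, so
    that the condition coincides with that of [left_singularP]. *)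
Lemma right_singularP (t : T) : right_singular R t <->
  forall s, s \in R -> (forall r, r \in R -> r * t = 0 -> r * s = 0) -> s = 0.
Proof.
rewrite /right_singular /singular_submodule /=.
rewrite essential_annihilatorP; last first.
- move=> a b ta0; change (t * (val (b : subring R) * val (a : subring R)) = 0).
  by rewrite mulrA; apply: insert0.
- move=> x xx; apply/(@val_inj _ _ (subring R)); apply: redT.
  by rewrite -rmorphM (xx : (x : subring R) * x = 0) raddf0.
split=> h s.
  move=> Rs hs; apply: (congr1 val (h (Sub s Rs : subring R) _)) => a at0.
  apply/(@val_inj _ _ (subring R)); change (s * val (a : subring R) = 0).
  by apply: mulC0; apply: hs; [exact: valP | exact: mulC0].
move=> hs; apply/(@val_inj _ _ (subring R)); apply: h => [|r Rr rt0]; first exact: valP.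
by apply: mulC0; apply: (congr1 val (hs (Sub r Rr : subring R) _)); exact: mulC0.
Qed.

Lemma left_right_singular : left_singular R = right_singular R.
Proof.
apply/seteqP; split=> t; first by move/left_singularP/right_singularP.
by move/right_singularP/left_singularP.
Qed.

Lemma two_sided_ideal_singular : two_sided_ideal (left_singular R).
Proof.
split.
- by apply/left_singularP => s Rs /(_ 1 (rpred1 _) (mulr0 _)); rewrite mul1r.
(* If [r] kills [x] and [r'] kills [y], then [r' * r] kills [x + y]; the criterion is applied first
   for [x], then for [y]. *)
- move=> x y /left_singularP hx /left_singularP hy; apply/left_singularP => s Rs hs.
  apply: hx => // r Rr rx0; apply: hy; first exact: rpredM.
  move=> r' Rr' r'y0; rewrite mulrA; apply: hs; first exact: rpredM.
  by rewrite mulrDr -mulrA rx0 mulr0 add0r; exact: insert0.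
(* Whatever kills [x] kills [x * a], and also [a * x] by insertion; here [a] is any element of
   [T]. *)
- move=> a x /left_singularP hx; split; apply/left_singularP => s Rs hs.
    by apply: hx => // r Rr rx0; apply: hs => //; rewrite mulrA; exact: insert0.
  by apply: hx => // r Rr rx0; apply: hs => //; rewrite mulrA rx0 mul0r.
Qed.

(** Being in [R], the element [x] may serve as its own [s] in the criterion. *)
Lemma singular_subring0 (x : T) : x \in R -> left_singular R x -> x = 0.
Proof. by move=> Rx /left_singularP; apply. Qed.

Lemma left_socle_singular (r z : T) : left_socle R r -> left_singular R z -> r * z = 0.
Proof. by move=> [x sx <-] Zz; exact: (socle_annihilator _ _ Zz sx). Qed.

Lemma right_socle_singular (r z : T) : right_socle R r -> left_singular R z -> r * z = 0.
Proof.
move=> [x sx <-]; rewrite left_right_singular => Zz; apply: mulC0.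
exact: (socle_annihilator _ _ Zz sx).
Qed.

End Singular.

(** * The second isomorphism theorem and quotients that are domains *)

Section Quotient.
Context {T : pzRingType}.
Implicit Types (R : subringClosed T) (P : idealClosed T).

(** As [T = R + P], each [t] is congruent modulo [P] to some [g t] in [R]. The map is induced by
    [g], and [fE] shows that it does not depend on this choice. *)
Lemma ring_quot_restrict_isomorphic R P :
  (forall t, exists2 r, r \in R & t - r \in P) ->
  ring_isomorphic (ring_quot P) (ring_quot (restrict_ideal R P)).
Proof.
move=> RP.
pose p (t : T) : ring_quot P := \pi_(Quotient.quot P)%qT t.
pose q (r : subring R) : ring_quot (restrict_ideal R P) :=
  \pi_(Quotient.quot (restrict_ideal R P))%qT r.
have p_eq t u : t - u \in P -> p t = p u by move=> h; exact/ring_quot_eq.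
have q_eq r s : val r - val s \in P -> q r = q s.
  by move=> h; apply/ring_quot_eq; rewrite inE raddfB.
have /choice[g gP] t : exists r : subring R, t - val r \in P.
  by have [r Rr tr] := RP t; exists (Sub r Rr).
pose f (x : ring_quot P) := q (g (repr (x : Quotient.quot P))).
have fE t r : t - val r \in P -> f (p t) = q r.
  move=> tr; apply: q_eq; have := gP (repr (p t : Quotient.quot P)).
  set u := repr _ => gu; have ut : u - t \in P by exact: ring_quot_repr.
  have -> : val (g u) - val r = (u - t) + (t - val r) - (u - val (g u)).
    by rewrite subrKA opprB [RHS]addrC subrKA.
  by apply: rpredB gu; apply: rpredD.
have fD : GRing.zmod_morphism f.
  move=> x y; have [[t ->] [u ->]] := conj (ring_quotP x) (ring_quotP y).
  have -> : \pi_(Quotient.quot P)%qT t - \pi_(Quotient.quot P)%qT u = p (t - u).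
    exact: esym (raddfB \pi_(Quotient.quot P)%qT t u).
  rewrite (fE _ (g t - g u)); last first.
    have -> : t - u - val (g t - g u) = (t - val (g t)) - (u - val (g u)).
      by rewrite raddfB !opprD !opprK addrACA.
    by apply: rpredB; exact: gP.
  rewrite -!/(p _) (fE t _ (gP t)) (fE u _ (gP u)).
  exact: (raddfB \pi_(Quotient.quot (restrict_ideal R P))%qT).
have fM : GRing.monoid_morphism f.
  split; first by apply: (fE 1 1); rewrite rmorph1 subrr rpred0.
  move=> x y; have [[t ->] [u ->]] := conj (ring_quotP x) (ring_quotP y).
  have -> : (\pi_(Quotient.quot P)%qT t : ring_quot P) * \pi_(Quotient.quot P)%qT u = p (t * u).
    exact: ring_quot_mulE.
  rewrite (fE _ (g t * g u)); last first.
    have -> : t * u - val (g t * g u) = (t - val (g t)) * u + val (g t) * (u - val (g u)).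
      by rewrite rmorphM mulrBl mulrBr addrA subrK.
    by apply: rpredD; [exact: (@Defs.idealMr _ P _ _) (gP t) | exact: (@Defs.idealMl _ P _ _) (gP u)].
  rewrite -!/(p _) (fE t _ (gP t)) (fE u _ (gP u)).
  exact: esym (@ring_quot_mulE _ (restrict_ideal R P) _ _).
pose F : {rmorphism ring_quot P -> ring_quot (restrict_ideal R P)} :=
  HB.pack f (GRing.isZmodMorphism.Build _ _ f fD) (GRing.isMonoidMorphism.Build _ _ f fM).
exists F; exists (fun y => p (val (repr (y : Quotient.quot (restrict_ideal R P))))) => [x|y].
  have [t ->] := ring_quotP x; rewrite /= -/(p t) (fE t _ (gP t)).
  apply: p_eq; set r := repr _.
  have rg : r - g t \in restrict_ideal R P by exact: ring_quot_repr.
  rewrite inE raddfB in rg.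
  have -> : val r - t = (val r - val (g t)) - (t - val (g t)) by rewrite opprB subrKA.
  by apply: rpredB; rewrite ?gP.
have [r ->] := ring_quotP y; rewrite /= (fE _ (repr (q r : Quotient.quot _))); last first.
  by rewrite subrr rpred0.
exact: (reprK (q r : Quotient.quot _)).
Qed.

Lemma ring_quot_domain P : [set` P] <> setT ->
  (forall x y, x * y \in P -> x \in P \/ y \in P) -> domain (ring_quot P).
Proof.
move=> PT prP; have p0 t : (\pi_(Quotient.quot P)%qT t : ring_quot P) = 0 -> t \in P.
  have <- : (\pi_(Quotient.quot P)%qT 0 : ring_quot P) = 0 by exact: (raddf0 \pi_(Quotient.quot P)%qT).
  by move/ring_quot_eq; rewrite subr0.
have p0' t : t \in P -> (\pi_(Quotient.quot P)%qT t : ring_quot P) = 0.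
  have <- : (\pi_(Quotient.quot P)%qT 0 : ring_quot P) = 0 by exact: (raddf0 \pi_(Quotient.quot P)%qT).
  by move=> Pt; apply/ring_quot_eq; rewrite subr0.
split.
  move/p0 => P1; apply: PT; apply/seteqP; split=> // t _ /=.
  by rewrite -[t]mulr1; exact: (@Defs.idealMl _ P).
move=> x y; have [[t ->] [u ->]] := conj (ring_quotP x) (ring_quotP y).
by move=> tu0; have [] := prP t u; [apply: p0; rewrite -ring_quot_mulE | left; exact: p0' | right; exact: p0'].
Qed.

End Quotient.

(** * Consequences of maximality when a nonzero singular element exists *)

Section NonzeroSingular.
Context {T : pzRingType} {R : subringClosed T}.
Hypotheses (redT : forall x : T, x * x = 0 -> x = 0) (maxR : maximal_subring R).

Let mulC0 (x y : T) : x * y = 0 -> y * x = 0.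
Proof. exact: (@reduced_mulC _ _ two_sided_ideal0 redT). Qed.

Local Notation Z := (left_singular R).
Let idZ : two_sided_ideal Z := two_sided_ideal_singular redT.

(* X is a nonunital subring normalized by R, so R + X is a subring meeting
   the maximality of R; then X = Z by the modular law, as R meets Z trivially. *)
Lemma singular_eq (X : set T) (x : T) :
  X 0 -> (forall y z, X y -> X z -> X (y + z)) ->
  (forall y z, X y -> X z -> X (y * z)) ->
  (forall r y, r \in R -> X y -> X (r * y) /\ X (y * r)) ->
  X `<=` Z -> x <> 0 -> X x ->
  X = Z /\ forall t, exists2 r, r \in R & exists2 z, Z z & t = r + z.
Proof.
move=> X0 XD XM XR XZ x0 Xx.
(* A nonzero singular element is never in [R], so [X] is not inside [R]. *)
have TX : forall t, exists2 r, r \in R & exists2 y, X y & t = r + y.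
  apply: maximal_subringD => // XR'; apply: x0.
  by apply: (@singular_subring0 _ R redT); [exact: XR' | exact: XZ].
split; last by move=> t; have [r Rr [y /XZ Zy ->]] := TX t; exists r => //; exists y.
apply/seteqP; split=> // z Zz; have [r Rr [y Xy Ez]] := TX z.
have r0 : r = 0.
  apply: (@singular_subring0 _ R redT) => //.
  by rewrite -[r](addrK y) -Ez; apply: two_sided_idealB => //; exact: XZ.
by rewrite Ez r0 add0r.
Qed.

Lemma singular_ideal_eq (J : set T) (x : T) :
  two_sided_ideal J -> J `<=` Z -> x <> 0 -> J x -> J = Z.
Proof.
move=> [J0 JD JM] JZ x0 Jx.
have [|||||-> _] // := singular_eq J x J0 JD.
- by move=> y z _ Jz; exact: (JM _ _ Jz).1.
- by move=> r y _; exact: JM.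
Qed.

(** Each set absorbs [T] on one side and [R] on the other. Absorbing [T] on one side already gives
    closure under products, so [singular_eq] applies. *)
Lemma singular_mulT (x : T) : x <> 0 -> Z x ->
  sums_of_products [set` R] x setT = Z /\ sums_of_products setT x [set` R] = Z.
Proof.
move=> x0 Zx; have [Z0 ZD ZM] := idZ.
have R1 : [set` R] 1 by exact: rpred1.
have subZ A B : sums_of_products A x B `<=` Z.
  apply: sums_of_products_sub => // a b _ _.
  by apply: (ZM _ _ _).2; apply: (ZM _ _ _).1.
split.
- have [|y z|y z hy _|r y Rr hy||||-> _] // := @singular_eq (sums_of_products [set` R] x setT) x.
  + exact: sums_of_products0.
  + exact: sums_of_productsD.
  + exact: (sums_of_products_mulr (fun _ _ => I) hy).
  + split; last exact: (sums_of_products_mulr (fun _ _ => I) hy).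
    by apply: (sums_of_products_mull _ hy) => a Ra; exact: rpredM.
  + exact: sums_of_products1.
- have [|y z|y z _ hz|r y Rr hy||||-> _] // := @singular_eq (sums_of_products setT x [set` R]) x.
  + exact: sums_of_products0.
  + exact: sums_of_productsD.
  + exact: (sums_of_products_mull (fun _ _ => I) hz).
  + split; first exact: (sums_of_products_mull (fun _ _ => I) hy).
    by apply: (sums_of_products_mulr _ hy) => b Rb; exact: rpredM.
  + exact: sums_of_products1.
Qed.

Hypothesis Z_neq0 : Z <> [set 0].

Lemma singular_nontrivial : exists2 x, x <> 0 & Z x.
Proof.
apply: contrapT => h; apply: Z_neq0; apply/seteqP; split=> [x Zx|_ ->]; last by case: idZ.
by apply: contrapT => x0; apply: h; exists x.
Qed.

Lemma singular_complement (t : T) : exists2 r, r \in R & exists2 z, Z z & t = r + z.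
Proof.
have [x x0 Zx] := singular_nontrivial; have [Z0 ZD ZM] := idZ.
have [|||||_ TZ] // := singular_eq Z x Z0 ZD.
- by move=> y z _ Zz; exact: (ZM _ _ Zz).1.
- by move=> r y _; exact: ZM.
Qed.

Lemma singular_direct_sum : internal_direct_sum [set` R] Z.
Proof.
split; apply/seteqP.
  split=> // t _.
  by have [r Rr [z Zz ->]] := singular_complement t; exists r => //; exists z.
split=> [x [Rx Zx]|_ ->].
- exact: (@singular_subring0 _ R redT).
- by split; [exact: rpred0 | case: idZ].
Qed.

Lemma singular_minimal_ideal : minimal_ideal Z.
Proof.
split=> // J idJ JZ; have [J0|] := pselect (J = [set 0]); [by left | move=> nJ0; right].
have [x [Jx x0]] : exists x, J x /\ x <> 0.
  apply: contrapT => h; apply: nJ0; apply/seteqP; split=> [x Jx|_ ->]; last by case: idJ.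
  by apply: contrapT => x0; apply: h; exists x.
exact: (singular_ideal_eq J x).
Qed.

Lemma ann_singularP (A : set T) (s : T) :
  ann_in A Z s <-> A s /\ forall z, Z z -> s * z = 0.
Proof.
split=> -[As h]; split=> // z Zz; first by case: (h z Zz).
by have sz := h z Zz; split=> //; exact: mulC0.
Qed.

(** If [T] times [s] stays in [R], its products with elements of [Z] lie in both [R] and [Z], hence
    vanish. Conversely, if [s] kills [Z], multiplying [s] by [r + z] amounts to multiplying it by
    [r]. *)
Lemma conductor_singular :
  [/\ conductor [set` R] = ann_in [set` R] Z,
      lconductor [set` R] = ann_in [set` R] Z
    & rconductor [set` R] = ann_in [set` R] Z].
Proof.
have [Z0 ZD ZM] := idZ.
have annMl t s : s \in R -> (forall z, Z z -> s * z = 0) -> t * s \in R.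
  move=> Rs sZ; have [r Rr [z Zz ->]] := singular_complement t.
  by rewrite mulrDl (mulC0 _ _ (sZ z Zz)) addr0; exact: rpredM.
have annMr t s : s \in R -> (forall z, Z z -> s * z = 0) -> s * t \in R.
  move=> Rs sZ; have [r Rr [z Zz ->]] := singular_complement t.
  by rewrite mulrDr (sZ z Zz) addr0; exact: rpredM.
have lcond s : (forall t, t * s \in R) -> ann_in [set` R] Z s.
  move=> Ts; apply/ann_singularP; split; first by rewrite /= -[s]mul1r.
  move=> z Zz; apply: mulC0; apply: (@singular_subring0 _ R redT) => //.
  exact: (ZM _ _ Zz).2.
split; apply/seteqP; split=> s.
- move=> sub; apply: lcond => t; apply: sub; rewrite -[t * s]mulr1.
  exact: sums_of_products_mul.
- move=> /ann_singularP[Rs sZ]; apply: sums_of_products_sub => /=.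
  + exact: rpred0.
  + by move=> y z; exact: rpredD.
  + move=> a b _ _; apply: annMr; first exact: annMl.
    by move=> z Zz; rewrite -mulrA sZ ?mulr0.
- by move/lcond.
- by move=> /ann_singularP[Rs sZ] t; exact: annMl.
- move=> sT; apply/ann_singularP; split; first by rewrite /= -[s]mulr1; exact: sT.
  move=> z Zz; apply: (@singular_subring0 _ R redT); first exact: sT.
  exact: (ZM _ _ Zz).1.
- by move=> /ann_singularP[Rs sZ] t; exact: annMr.
Qed.

(** The left description gives absorption on the left, the right description absorption on the
    right. *)
Lemma two_sided_ideal_conductor : two_sided_ideal (conductor [set` R]).
Proof.
have [EC El Er] := conductor_singular.
have CE x : conductor [set` R] x -> (forall t, t * x \in R) /\ (forall t, x * t \in R).
  move=> Cx; split; [have : lconductor [set` R] x | have : rconductor [set` R] x] => //.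
    by rewrite El -EC.
  by rewrite Er -EC.
rewrite EC -El; split=> [t|x y|a x].
- by rewrite mulr0; exact: rpred0.
- by move=> Cx Cy t; rewrite mulrDr; apply: rpredD; [exact: Cx | exact: Cy].
- rewrite El -EC => /CE[Tx xT]; split; rewrite EC; [rewrite -El | rewrite -Er] => t.
    by rewrite mulrA; exact: Tx.
  by rewrite /= -mulrA; exact: xT.
Qed.

Lemma two_sided_ideal_ann_singular : two_sided_ideal (ann_in setT Z).
Proof.
have [_ _ ZM] := idZ; split.
- by apply/ann_singularP; split=> // z _; rewrite mul0r.
- move=> x y /ann_singularP[_ xZ] /ann_singularP[_ yZ]; apply/ann_singularP.
  by split=> // z Zz; rewrite mulrDl xZ // yZ // addr0.
- move=> a x /ann_singularP[_ xZ]; split; apply/ann_singularP; split=> // z Zz.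
    by rewrite -mulrA xZ // mulr0.
  by rewrite -mulrA xZ //; exact: (ZM _ _ Zz).1.
Qed.

Lemma ann_singular_not_singular : ~ Z `<=` ann_in setT Z.
Proof.
move=> ZQ; have [x x0 Zx] := singular_nontrivial.
by apply: x0; apply: redT; exact: ((ZQ x Zx).2 x Zx).1.
Qed.

(** By minimality of [Z], an ideal not killing [Z] contains [Z]. The product of two such ideals
    contains all squares of elements of [Z], and these cannot all kill [Z] since [T] is reduced. *)
Lemma ann_singular_minimal_prime : minimal_prime (ann_in setT Z).
Proof.
have idQ := two_sided_ideal_ann_singular; have [_ _ ZM] := idZ.
have Z_sub J : two_sided_ideal J -> ~ J `<=` ann_in setT Z -> Z `<=` J.
  move=> idJ JQ; have [J0 JD JM] := idJ.
  have [a Ja [z [Zz az]]] : exists2 a, J a & exists z, Z z /\ a * z <> 0.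
    apply: contrapT => h; apply: JQ => a Ja; apply/ann_singularP; split=> // z Zz.
    by apply: contrapT => az; apply: h; exists a => //; exists z.
  have <- : J `&` Z = Z; last by move=> y [].
  apply: (singular_ideal_eq _ (a * z)) => //.
  - exact: two_sided_idealI.
  - by split; [exact: (JM _ _ Ja).2 | exact: (ZM _ _ Zz).1].
split=> [||P' [[P0 PD PM] PT prP'] _ P'Q]; last first.
(* The products of the annihilator with [Z] are zero, so [P'] contains one of the two; it cannot
   contain [Z], being inside the annihilator. *)
- apply/seteqP; split=> // q Qq.
  have QZ x z : ann_in setT Z x -> Z z -> P' (x * z).
    by move=> [_ xZ] Zz; rewrite (xZ z Zz).1.
  have [sub|sub] := prP' _ _ idQ idZ QZ; first exact: sub.
  by case: ann_singular_not_singular => z /sub /P'Q.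
- by move=> _ ->; case: idQ.
- split=> // [QT|I J idI idJ IJ].
    by apply: ann_singular_not_singular; rewrite QT.
  apply: contrapT => /not_orP[/(Z_sub _ idI) ZI /(Z_sub _ idJ) ZJ].
  have [x x0 Zx] := singular_nontrivial.
  have /ann_singularP[_ /(_ _ Zx) xxx] := IJ _ _ (ZI _ Zx) (ZJ _ Zx).
  (* The hypothesis [redT] concerns squares only, so the vanishing cube is used through the square
     of [x * x]. *)
  by apply: x0; apply: redT; apply: redT; rewrite mulrA xxx mul0r.
Qed.

Lemma socle_conductor :
  left_socle R `<=` conductor [set` R] /\ right_socle R `<=` conductor [set` R].
Proof.
have [-> _ _] := conductor_singular; split=> r soc_r; apply/ann_singularP; split.
- by case: soc_r => x _ <-; exact: valP.
- by move=> z; exact: left_socle_singular.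
- by case: soc_r => x _ <-; exact: (valP (x : subring R)).
- by move=> z; exact: right_socle_singular.
Qed.

(** For [x = r + z], the square of [r] lies in both [R] and [Z], so it vanishes, and [r] with it. *)
Lemma singular_reduced_modulo (x : T) : Z (x * x) -> Z x.
Proof.
have [Z0 ZD ZM] := idZ; have [r Rr [z Zz ->]] := singular_complement x => Zxx.
apply: (ZD) => //; rewrite (redT r) //.
apply: (@singular_subring0 _ R redT); first exact: rpredM.
have -> : r * r = (r + z) * (r + z) - (r * z + z * (r + z)).
  by rewrite [X in X - _]mulrDl mulrDr -[X in X - _]addrA addrK.
by apply: (two_sided_idealB idZ) => //; apply: ZD; [exact: (ZM _ _ Zz).1 | exact: (ZM _ _ Zz).2].
Qed.

(** From [T = R + Z] and [Z] inside [P] comes [T = R + P], hence the isomorphism; reducedness modulo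
    [Z] makes [P] completely prime. *)
Lemma minimal_prime_over_singular (P : idealClosed T) :
  minimal_prime_over Z [set` P] ->
  ring_isomorphic (ring_quot P) (ring_quot (restrict_ideal R P)) /\
  domain (ring_quot P).
Proof.
move=> minP; have [[_ PT _] ZP _] := minP; split.
  apply: ring_quot_restrict_isomorphic => t.
  have [r Rr [z Zz ->]] := singular_complement t.
  by exists r => //; rewrite addrAC subrr add0r; exact: ZP.
apply: ring_quot_domain => // x y.
exact: (minimal_prime_over_completely_prime idZ singular_reduced_modulo _ minP).
Qed.

(** Every class modulo [R] is that of some [z] in [Z], and the essential annihilator of [z] kills
    this class. *)
Lemma singular_factor :
  singular_module (left_factor R) /\ singular_module (right_factor R).
Proof.
have piE r z : r \in R -> (\pi_(Quotient.quot R) (r + z) = \pi_(Quotient.quot R) z)%qT.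
  by move=> Rr; apply: (proj2 (@factor_eq T R _ _)); rewrite addrK.
split; apply/seteqP; split=> // x _; have [t ->] := @factorP T R x;
  have [r Rr [z Zz ->]] := singular_complement t; rewrite piE //.
  apply: (@essential_annihilator_sub _ (left_module R) _ z) => // a az.
  apply: etrans (@left_factor_scaleE T R a z) _.
  by rewrite (az : val a * z = 0); exact: (raddf0 \pi_(Quotient.quot R)%qT).
rewrite left_right_singular // in Zz.
apply: (@essential_annihilator_sub _ (right_module R) _ z) => // a za.
apply: etrans (@right_factor_scaleE T R a z) _.
by rewrite (za : z * val (a : subring R) = 0); exact: (raddf0 \pi_(Quotient.quot R)%qT).
Qed.

End NonzeroSingular.

Theorem theorem3p6 (T : pzRingType) (R : subringClosed T) :
  reduced T -> maximal_subring R ->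
  left_singular R = right_singular R /\
  let Z := left_singular R in
  let C := conductor [set` R] in
  let Q := ann_in [set: T] Z in
  (two_sided_ideal Z /\ Z <> [set: T]) /\
  (Z = [set 0] \/
   [/\ [/\ internal_direct_sum [set` R] Z,
           minimal_ideal Z
         & forall x : T, x <> 0 -> Z x ->
             sums_of_products [set` R] x [set: T] = Z /\
             sums_of_products [set: T] x [set` R] = Z],
       [/\ [/\ C = lconductor [set` R], C = rconductor [set` R]
             & C = ann_in [set` R] Z],
           two_sided_ideal C,
           left_socle R `<=` C /\ right_socle R `<=` C,
           minimal_prime Q
         & Q `&` [set` R] = C],
       forall P : idealClosed T, minimal_prime_over Z [set` P] ->
         ring_isomorphic (ring_quot P) (ring_quot (restrict_ideal R P)) /\
         domain (ring_quot P)
     & singular_module (left_factor R) /\ singular_module (right_factor R)]).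
Proof.
move=> redT0 maxR.
have redT (x : T) : x * x = 0 -> x = 0 by move=> xx; apply: (redT0 x 2); rewrite expr2.
split; first exact: left_right_singular.
split.
  split; first exact: two_sided_ideal_singular.
  (* If [1] were singular, it would be [0] as an element of [R]; then [T] would be zero and equal to
     [R]. *)
  move=> ZT; apply: maxR.1; apply/seteqP; split=> // t _.
  have t0 : t = 0.
    rewrite -[t]mul1r (@singular_subring0 _ R redT 1) ?mul0r ?rpred1 //.
    by rewrite ZT.
  by rewrite t0; exact: rpred0.
have [Z0|Z0] := pselect (left_singular R = [set 0]); first by left.
right; have [EC El Er] := conductor_singular redT maxR Z0.
split.
- split; first exact: singular_direct_sum.
    exact: singular_minimal_ideal.
  by move=> x; exact: singular_mulT.
- have QRC : ann_in [set: T] (left_singular R) `&` [set` R] = conductor [set` R].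
    by rewrite EC; apply/seteqP; split=> s [] => [[_ sZ] Rs|Rs sZ].
  split=> //.
  + by rewrite El Er EC.
  + exact: two_sided_ideal_conductor.
  + exact: socle_conductor.
  + exact: ann_singular_minimal_prime.
- by move=> P; exact: minimal_prime_over_singular.
- exact: singular_factor.
Qed.
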